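(* For each $\epsilon \in (0,1)$, let $t_{\epsilon}:[0,1]\to\mathbb{R}$ be a function with $t_{\epsilon}(0)=\epsilon$ satisfying the differential equation \[t'_{\epsilon}(x)= \log t_{\epsilon}(x)\, \frac{t_{\epsilon}(x)\,(1 - t_{\epsilon}(x))}{x - (1+x)\, t_{\epsilon}(x)}.\] Let $L = \lim_{\epsilon \to 0} t_{\epsilon}(1)$ and let $C = (L(1-L))^{-1/2}$. Then \[c_t \geq C^{-(1+o(1))t^2},\] where $o(1)$ denotes a quantity tending to $0$ as $t\to\infty$.
   Context: For a graph $G$, $k_t(G)$ denotes the number of complete subgraphs on $t$ vertices in $G$, and $\overline{G}$ is the complement of $G$. Let $k_t(n) = \min\{k_t(G) + k_t(\overline{G}) : |G| = n\}$, i.e. the minimum number of monochromatic copies of $K_t$ in a two-colouring of the edges of $K_n$. The Ramsey multiplicity constant is $c_t = \lim_{n\to\infty} k_t(n)/\binom{n}{t}$ (this limit exists since the ratios $k_t(n)/\binom{n}{t}$ are nondecreasing in $n$ and bounded by $1$). Here $\log$ is the natural logarithm. *)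

(* Defs.v *)
From HB Require Import structures.
From mathcomp Require Export all_boot all_order all_algebra.
From mathcomp Require Export all_classical all_reals all_analysis.

Set Implicit Arguments.
Unset Strict Implicit.
Unset Printing Implicit Defensive.

Export Order.TTheory GRing.Theory Num.Theory.
Export numFieldNormedType.Exports.

(* A finite simple graph with vertex type T is given by its edge set. *)
Definition simple_graph (T : finType) (E : {set {set T}}) : bool :=
  [forall e in E, #|e| == 2].

Definition graph_compl (T : finType) (E : {set {set T}}) : {set {set T}} :=
  [set e : {set T} | (#|e| == 2) && (e \notin E)].

Definition is_clique (T : finType) (E : {set {set T}}) (A : {set T}) : bool :=
  [forall x in A, forall y in A, (x != y) ==> ([set x; y]%SET \in E)].

Definition num_cliques (T : finType) (t : nat) (E : {set {set T}}) : nat :=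
  #|[set A : {set T} | (#|A| == t) && is_clique E A]|.

Definition mono_cliques (T : finType) (t : nat) (E : {set {set T}}) : nat :=
  (num_cliques t E + num_cliques t (graph_compl E))%N.

(* The minimum of k_t(G) + k_t(complement of G) over the graphs G on n
   vertices; the empty graph witnesses that the range is nonempty. *)
Definition min_mono_cliques (t n : nat) : nat :=
  mono_cliques t
    [arg min_(E < (finset.set0 : {set {set 'I_n}}) | simple_graph E)
       mono_cliques t E]%N.

Lemma simple_graph_set0 (T : finType) :
  simple_graph (finset.set0 : {set {set T}}).
Proof. by apply/forall_inP => e; rewrite finset.inE. Qed.

Lemma min_mono_cliques_le (t n : nat) (E : {set {set 'I_n}}) :
  simple_graph E -> (min_mono_cliques t n <= mono_cliques t E)%N.
Proof.
rewrite /min_mono_cliques; case: arg_minnP; first exact: simple_graph_set0.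
by move=> F _ Fmin /Fmin.
Qed.

Lemma min_mono_cliques_ex (t n : nat) : exists E : {set {set 'I_n}},
  simple_graph E /\ mono_cliques t E = min_mono_cliques t n.
Proof.
rewrite /min_mono_cliques; case: arg_minnP; first exact: simple_graph_set0.
by move=> F sF _; exists F.
Qed.

Local Open Scope classical_set_scope.
Local Open Scope ring_scope.

Definition ramsey_mult_const (R : realType) (t : nat) : R :=
  lim ((min_mono_cliques t n)%:R / 'C(n, t)%:R @[n --> \oo] : set_system R).

(* Derivative of f at x relative to A: only the values of f on A matter, and
   at an endpoint of an interval A this is the one-sided derivative. *)
Definition has_deriv_within (R : realType) (A : set R) (f : R -> R) (x l : R)
  : Prop :=
  (f y - f x) / (y - x) @[y --> within A x^'] --> l.

(* y' = log y * y (1 - y) / (x - (1 + x) y) on [0, 1].  Both ln and division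
   are total, so the requirement that the right-hand side is defined
   (y > 0 and nonzero denominator) is explicit. *)
Definition solves_ode (R : realType) (y : R -> R) : Prop :=
  forall x : R, 0 <= x <= 1 ->
    [/\ 0 < y x,
        x - (1 + x) * y x != 0 &
        has_deriv_within `[0, 1] y x
          (ln (y x) * (y x * (1 - y x) / (x - (1 + x) * y x)))].

(* Main.v *)
(* Call the two colour classes red and blue.  Following the neighbourhood proof
   of Ramsey's theorem, but keeping every vertex, a large set of [n] vertices
   contains at least [M i j * n ^ i / i!] red [K_i] or [M i j * n ^ j / j!] blue
   [K_j] as soon as [M i j] is at most [M (i-1) j * p ^ m / 2] and
   [M i (j-1) * q ^ m / 2], where [m = max i j] and [p + q < 1].  Writing
   [M = exp (- F)], this asks for a function [F] with
   [exp (- F_x / m) + exp (- F_y / m) <= 1].  The homogeneous solutions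
   [F = x ^ 2 * f (y / x)] on [y <= x] have [F_x = - x ln (1 - tau (y / x))] and
   [F_y = - x ln (tau (y / x))]; the integrability condition is exactly the
   differential equation of the theorem.  As [tau] increases, [f] is concave, so
   discretisation costs nothing, and [F t t = t ^ 2 * f 1] with
   [f 1 = - ln (L (1 - L)) / 2] in the limit.  Reflected in the diagonal, [F]
   has a convex kink there, which averaging removes because the set of
   admissible gradients is convex.

   The limit in [eps] exists because the right-hand side of the equation is
   decreasing in the unknown, so that solutions stay ordered. *)

Require Import Defs.
From mathcomp Require Import ring lra zify.

Set Implicit Arguments.
Unset Strict Implicit.
Unset Printing Implicit Defensive.

Local Open Scope classical_set_scope.
Local Open Scope ring_scope.

Section WithinDerivative.
Variable R : realType.
Implicit Types (A : set R) (f g : R -> R) (a b c x l : R).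

Lemma has_deriv_within_continuous A f :
  (forall x, A x -> exists l, has_deriv_within A f x l) ->
  {within A, continuous f}.
Proof.
move=> df; apply/subspace_continuousP => x Ax; have [l dfx] := df x Ax.
have sub0 : y - x @[y --> within A x^'] --> (0 : R).
  rewrite -(subrr x); apply: cvgB; last exact: cvg_cst.
  by apply: cvg_within_filter; apply: cvg_within_filter; exact: cvg_id.
have linear_approx : f x + (f y - f x) / (y - x) * (y - x)
    @[y --> within A x^'] --> f x.
  rewrite -[X in _ --> X]addr0 -[in X in _ --> X](mulr0 l).
  by apply: cvgD; [exact: cvg_cst|exact: cvgM].
apply/cvgrPdist_lt => e e0.
have fe : \forall y \near x, y != x -> A y ->
    `|f x - (f x + (f y - f x) / (y - x) * (y - x))| < e.
  by move/cvgrPdist_lt : linear_approx; apply.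
suff : \forall y \near x, A y -> `|f x - f y| < e by [].
near=> y => Ay; have [->|yx] := eqVneq y x; first by rewrite subrr normr0.
have -> : f y = f x + (f y - f x) / (y - x) * (y - x).
  by rewrite divfK ?subr_eq0// addrC subrK.
by move: yx Ay; near: y.
Unshelve. all: by end_near. Qed.

Lemma has_deriv_within_is_derive A f x l : nbhs x A ->
  has_deriv_within A f x l -> is_derive x (1 : R) f l.
Proof.
move=> xA dfx; pose g z := if z == x then l else (f z - f x) / (z - x).
apply/is_derive1_caratheodory; exists g; split; last by rewrite /g eqxx.
- move=> z; rewrite /g; case: eqVneq => [->|zx]; first by rewrite !subrr mulr0.
  by rewrite divfK ?subr_eq0.
- apply/continuous_withinNx; rewrite [g x]/g eqxx.
  have quotient_cvg : (f y - f x) / (y - x) @[y --> x^'] --> l.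
    apply: cvg_trans dfx => U AU.
    suff : \forall y \near x, y != x -> U ((f y - f x) / (y - x)) by [].
    by apply: filterS2 xA AU => y Ay /[swap] yx; apply.
  apply: cvg_trans quotient_cvg; apply: near_eq_cvg.
  by near=> y; rewrite /g ifN//; near: y; exact: nbhs_dnbhs_neq.
Unshelve. all: by end_near. Qed.

Lemma has_deriv_withinB A f g x l l' :
  has_deriv_within A f x l -> has_deriv_within A g x l' ->
  has_deriv_within A (f - g) x (l - l').
Proof.
move=> df dg; rewrite /has_deriv_within.
suff -> : (fun y => ((f - g) y - (f - g) x) / (y - x)) =
    (fun y => (f y - f x) / (y - x)) - (fun y => (g y - g x) / (y - x)).
  exact: cvgB.
by apply/funext => y; rewrite !fctE; ring.
Qed.

Lemma has_deriv_within_max_ge0 f a b c l : c \in `]a, b] ->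
  has_deriv_within `[a, b] f c l -> {in `[a, b], forall x, f x <= f c} ->
  0 <= l.
Proof.
rewrite in_itv/= => /andP[ac cb] dfc fmax.
have left_quotient : (f y - f c) / (y - c) @[y --> c^'-] --> l.
  apply: cvg_trans dfc => U abU.
  suff : \forall y \near c, y < c -> U ((f y - f c) / (y - c)) by [].
  have near_ca : \forall y \near c, a < y by exact: lt_nbhsr.
  apply: filterS2 near_ca abU => y ay yU yc; apply: yU; first by rewrite lt_eqF.
  by rewrite /= in_itv/= (ltW ay) (le_trans (ltW yc) cb).
apply: cvgr_to_ge left_quotient _; near=> y.
have yc : y < c by near: y; exact: nbhs_left_lt.
have ay : a < y by near: y; exact: nbhs_left_gt.
rewrite nmulr_lge0 ?invr_lt0 ?subr_lt0// subr_le0 fmax// in_itv/= (ltW ay)/=.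
exact: le_trans (ltW yc) cb.
Unshelve. all: by end_near. Qed.

(* A positive maximum on [a, b] would be attained to the right of [a], where the
   derivative cannot be negative. *)
Lemma has_deriv_within_lt0_le0 f a b : a <= b -> f a <= 0 ->
  {within `[a, b], continuous f} ->
  {in `[a, b], forall x, 0 < f x ->
     exists2 l, l < 0 & has_deriv_within `[a, b] f x l} ->
  {in `[a, b], forall x, f x <= 0}.
Proof.
move=> ab fa0 cf df x xab; have [c cab fmax] := EVT_max ab cf.
apply: le_trans (fmax x xab) _; rewrite leNgt; apply/negP => fc0.
have ac : a < c.
  rewrite lt_neqAle (itvP cab) andbT; apply: contraTneq fc0 => <-.
  by rewrite -leNgt.
have [l l0 dfc] := df c cab fc0.
have cab' : c \in `]a, b] by rewrite in_itv/= ac (itvP cab).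
by move: l0; rewrite ltNge (has_deriv_within_max_ge0 cab' dfc fmax).
Qed.

End WithinDerivative.

Section WithinContinuity.
Variables (T : topologicalType) (A : set T).

Lemma within_continuous_cst (U : topologicalType) (c : U) :
  {within A, continuous (cst c : T -> U)}.
Proof. by apply: continuous_subspaceT => x; exact: cvg_cst. Qed.

Lemma within_continuous_id : {within A, continuous (@id T)}.
Proof. by apply: continuous_subspaceT => x; exact: cvg_id. Qed.

Lemma within_continuousM (K : numFieldType) (f g : T -> K) :
  {within A, continuous f} -> {within A, continuous g} ->
  {within A, continuous (f * g)}.
Proof. by move=> cf cg x; apply: cvgM; [exact: cf|exact: cg]. Qed.

Lemma within_continuousV (K : numFieldType) (f : T -> K) :
  {within A, continuous f} -> (forall x, A x -> f x != 0) ->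
  {within A, continuous (@GRing.inv K \o f)}.
Proof.
move=> cf f0; apply: within_continuous_comp cf => _ /set_mem[x Ax <-].
exact/inv_continuous/f0.
Qed.

Lemma within_continuous_ln (R : realType) (f : T -> R) :
  {within A, continuous f} -> (forall x, A x -> 0 < f x) ->
  {within A, continuous (@ln R \o f)}.
Proof.
move=> cf f0; apply: within_continuous_comp cf => _ /set_mem[x Ax <-].
exact/continuous_ln/f0.
Qed.

End WithinContinuity.

Section Derivative.
Variable R : realType.
Implicit Types (f df k : R -> R) (a b K : R).

Lemma is_derive_ge0_nondecreasing f df a b :
  {in `]a, b[, forall x, is_derive x (1 : R) f (df x)} ->
  {in `]a, b[, forall x, 0 <= df x} -> {within `[a, b], continuous f} ->
  {in `[a, b] &, {homo f : x y / x <= y}}.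
Proof.
move=> fdf df0 cf; apply: ger0_derive1_le_cc cf => x /[dup] xab /fdf dfx.
  exact: ex_derive.
by rewrite derive1E derive_val df0.
Qed.

Lemma within_continuous_neq0_gt0 f a b :
  {within `[a, b], continuous f} -> {in `[a, b], forall x, f x != 0} ->
  0 < f a -> {in `[a, b], forall x, 0 < f x}.
Proof.
move=> cf f_neq0 fa0 x xab; rewrite ltNge; apply/negP => fx0.
have /andP[ax xb] : a <= x <= b := xab.
have axab : `[a, x] `<=` `[a, b] by exact: subset_itvl.
have [||c cax fc0] := @IVT _ f a x 0 ax.
- exact: continuous_subspaceW axab cf.
- by rewrite ge_min fx0 orbT le_max (ltW fa0).
- by have := f_neq0 c (axab c cax); rewrite fc0 eqxx.
Qed.

(* [f x ^ 2 * exp (2 K x)] is nondecreasing, so [f] cannot vanish. *)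
Lemma linear_ode_gt0 f k K a b :
  {within `[a, b], continuous f} ->
  {in `]a, b[, forall x, is_derive x (1 : R) f (k x * f x)} ->
  {in `]a, b[, forall x, - K <= k x} ->
  0 < f a -> {in `[a, b], forall x, 0 < f x}.
Proof.
move=> cf df kK fa0; pose h x := f x * f x * expR (2 * K * x).
have dh : {in `]a, b[, forall x,
    is_derive x (1 : R) h (2 * (K + k x) * (f x * f x) * expR (2 * K * x))}.
  by move=> x /df dfx; apply: is_derive_eq; rewrite /GRing.scale/=; ring.
have ch : {within `[a, b], continuous h}.
  apply: within_continuousM; first exact: within_continuousM.
  apply: continuous_subspaceT => x; apply: continuous_comp.
    by apply: continuousM => //; exact: cvg_cst.
  exact: continuous_expR.
have h_le : {in `[a, b] &, {homo h : x z / x <= z}}.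
  apply: is_derive_ge0_nondecreasing dh _ ch => x /kK kx.
  by rewrite mulr_ge0 ?expR_ge0// mulr_ge0 -?expr2 ?sqr_ge0//; lra.
have aab x : x \in `[a, b] -> a \in `[a, b].
  by rewrite !in_itv/= lexx => /andP[ax xb]; exact: le_trans xb.
apply: within_continuous_neq0_gt0 => // x xab.
have : h a <= h x by rewrite h_le ?(itvP xab)// (aab x).
apply: contraTneq => fx0; rewrite /h fx0 !mul0r -ltNge.
by rewrite !mulr_gt0 ?expR_gt0.
Qed.

Lemma le_tangent_of_derive_nonincreasing f df a b :
  {in `]a, b[, forall x, is_derive x (1 : R) f (df x)} ->
  {within `[a, b], continuous f} ->
  {in `[a, b] &, {homo df : x y /~ x <= y}} ->
  {in `[a, b] &, forall x y, f y <= f x + df x * (y - x)}.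
Proof.
move=> fdf cf df_le x y xab yab.
have mvt u v : u \in `[a, b] -> v \in `[a, b] -> u < v ->
    exists2 c, c \in `[a, b] & u < c < v /\ f v - f u = df c * (v - u).
  move=> uab vab uv; have uvab : `[u, v] `<=` `[a, b].
    by apply: subset_itv; rewrite bnd_simp ?(itvP uab) ?(itvP vab).
  have [z zuv||c cuv fc] := @MVT R f df u v uv.
  - apply: fdf; apply: subset_itv zuv;
      by rewrite bnd_simp ?(itvP uab) ?(itvP vab).
  - exact: continuous_subspaceW uvab cf.
  - by exists c => //; apply: uvab; exact: subset_itv_oo_cc.
case: (ltgtP x y) => [xy|yx|->]; last by rewrite subrr mulr0 addr0.
- have [c cab [/andP[xc _] fc]] := mvt x y xab yab xy.
  rewrite -lerBlDl fc ler_wpM2r ?subr_ge0 ?(ltW xy)//.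
  exact: df_le cab xab (ltW xc).
- have [c cab [/andP[_ cx] fc]] := mvt y x yab xab yx.
  rewrite -lerBlDl -opprB fc -[y - x]opprB mulrN lerN2.
  rewrite ler_wpM2r ?subr_ge0 ?(ltW yx)//.
  exact: df_le xab cab (ltW cx).
Qed.

End Derivative.

Section ArithmeticMean.
Variable R : numFieldType.
Implicit Types (u v : R^nat) (n : nat).

Lemma arithmetic_meanE u n :
  arithmetic_mean u n = n.+1%:R^-1 * \sum_(k < n.+1) u k.
Proof. by rewrite /arithmetic_mean/= seriesEord. Qed.

Lemma ler_arithmetic_mean u v n : (forall k, (k <= n)%N -> u k <= v k) ->
  arithmetic_mean u n <= arithmetic_mean v n.
Proof.
move=> uv; rewrite !arithmetic_meanE ler_wpM2l ?invr_ge0// ler_sum// => k _.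
by rewrite uv// -ltnS.
Qed.

Lemma arithmetic_mean_cst (x : R) n : arithmetic_mean (fun=> x) n = x.
Proof.
by rewrite arithmetic_meanE sumr_const card_ord -[x *+ _]mulr_natl mulKf.
Qed.

Lemma arithmetic_meanD u v n :
  arithmetic_mean (fun k => u k + v k) n =
  arithmetic_mean u n + arithmetic_mean v n.
Proof. by rewrite !arithmetic_meanE big_split mulrDr. Qed.

Lemma arithmetic_meanZ (x : R) u n :
  arithmetic_mean (fun k => x * u k) n = x * arithmetic_mean u n.
Proof. by rewrite !arithmetic_meanE -mulr_sumr mulrCA. Qed.

Lemma arithmetic_meanN u n :
  arithmetic_mean (fun k => - u k) n = - arithmetic_mean u n.
Proof. by rewrite !arithmetic_meanE sumrN mulrN. Qed.

Lemma arithmetic_mean_rev u n :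
  arithmetic_mean (fun k => u (n - k)%N) n = arithmetic_mean u n.
Proof. by rewrite !arithmetic_meanE [in RHS](reindex_inj rev_ord_inj). Qed.

End ArithmeticMean.

(* Average the tangent line bound [e ^ c * (1 + (u k - c)) <= e ^ (u k)] at the
   mean [c]. *)
Lemma expR_arithmetic_mean_le (R : realType) (u : R^nat) n :
  expR (arithmetic_mean u n) <= arithmetic_mean (fun k => expR (u k)) n.
Proof.
set c := arithmetic_mean u n.
have -> : expR c = arithmetic_mean (fun k => expR c * (1 + (u k - c))) n.
  rewrite arithmetic_meanZ !arithmetic_meanD !arithmetic_mean_cst.
  by rewrite subrr addr0 mulr1.
apply: ler_arithmetic_mean => k _.
by rewrite -ler_pdivlMl ?expR_gt0// mulrC -expRN -expRD expR_ge1Dx.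
Qed.

Section AsymptoticBounds.
Variable R : realType.

Lemma nbhs_right_itvoo (a b : R) : a < b -> \forall x \near a^'+, a < x < b.
Proof.
move=> ab; near do (apply/andP; split); first exact: nbhs_right_gt.
exact: nbhs_right_lt.
Unshelve. all: by end_near. Qed.

Lemma quadratic_eventually_le (a0 a1 a2 b : R) : a2 < b ->
  \forall t \near \oo, a2 * t%:R ^+ 2 + a1 * t%:R + a0 <= b * t%:R ^+ 2.
Proof.
move=> a2b; have ba0 : 0 < b - a2 by rewrite subr_gt0.
near=> t.
have t1 : 1 <= t%:R :> R by near: t; exact: nbhs_infty_ger.
have : (`|a1| + `|a0|) / (b - a2) <= t%:R by near: t; exact: nbhs_infty_ger.
set x : R := t%:R in t1 *; have x0 : 0 <= x by rewrite (le_trans ler01).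
rewrite ler_pdivrMr// => xbig.
have a1x : a1 * x <= `|a1| * x by rewrite ler_wpM2r ?ler_norm.
have a0x : a0 <= `|a0| * x by rewrite (le_trans (ler_norm _))// ler_peMr.
have : (`|a1| + `|a0|) * x <= x * (b - a2) * x by rewrite ler_wpM2r.
lra.
Unshelve. all: by end_near. Qed.

Lemma eventually_le_one_plus_o (u w : R^nat) : (forall t, 0 <= w t) ->
  (forall t, w t = 0 -> u t <= 0) ->
  (forall eta, 0 < eta -> \forall t \near \oo, u t <= (1 + eta) * w t) ->
  exists2 o : R^nat, o t @[t --> \oo] --> (0 : R) &
    forall t, u t <= (1 + o t) * w t.
Proof.
move=> w0 uw0 uw; exists (fun t => Num.max 0 (u t / w t - 1)).
- apply/cvgrPdist_le => eta eta0; near=> t.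
  rewrite sub0r normrN ger0_norm ?le_max ?lexx// ge_max (ltW eta0)/=.
  have [wt0|wt0] := eqVneq (w t) 0.
    by rewrite wt0 invr0 mulr0; lra.
  rewrite lerBlDl ler_pdivrMr; first by near: t; exact: uw.
  by rewrite lt_neqAle eq_sym wt0 w0.
- move=> t; have [wt0|wt0] := eqVneq (w t) 0; first by rewrite wt0 mulr0 uw0.
  have wt_gt0 : 0 < w t by rewrite lt_neqAle eq_sym wt0 w0.
  by rewrite -ler_pdivrMr// -lerBlDl le_max lexx orbT.
Unshelve. all: by end_near. Qed.

End AsymptoticBounds.

Section Cliques.
Variable T : finType.
Implicit Types (E : {set {set T}}) (A B C : {set T}) (v : T) (i : nat).

Definition cliques_in E A i : {set {set T}} :=
  [set B : {set T} | [&& B \subset A, #|B| == i & is_clique E B]]%SET.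

Definition nbhd_in E A v : {set T} :=
  [set u in A | (u != v) && ([set v; u]%SET \in E)]%SET.

Definition edge_cover E E' : Prop :=
  forall x y, x != y -> ([set x; y]%SET \in E) || ([set x; y]%SET \in E').

Lemma edge_cover_compl E : edge_cover E (graph_compl E).
Proof.
by move=> x y xy; rewrite finset.inE cards2 xy; case: (_ \in _).
Qed.

Lemma num_cliquesE E i : num_cliques i E = #|cliques_in E finset.setT i|.
Proof. by apply: eq_card => B; rewrite !finset.inE finset.subsetT. Qed.

Lemma leq_card_cliques_in E A B i : A \subset B ->
  (#|cliques_in E A i| <= #|cliques_in E B i|)%N.
Proof.
move=> AB; apply/subset_leq_card/fintype.subsetP => C; rewrite !finset.inE.
by move=> /and3P[CA -> ->]; rewrite (fintype.subset_trans CA AB).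
Qed.

Lemma card_cliques_in0 E A : #|cliques_in E A 0| = 1%N.
Proof.
apply/eqP/cards1P; exists finset.set0; apply/finset.setP => B.
rewrite !finset.inE cards_eq0; apply/and3P/eqP => [[_ /eqP //]|->].
split; rewrite ?finset.sub0set//.
by apply/forall_inP => x; rewrite finset.inE.
Qed.

Lemma nbhd_in_sub E A v : nbhd_in E A v \subset A.
Proof. by apply/fintype.subsetP => u; rewrite finset.inE => /andP[]. Qed.

Lemma card_nbhd_in_cover E E' A v : edge_cover E E' ->
  (#|A| <= (#|nbhd_in E A v| + #|nbhd_in E' A v|).+1)%N.
Proof.
move=> EE'; have sub : A \subset (v |: (nbhd_in E A v :|: nbhd_in E' A v))%SET.
  apply/fintype.subsetP => u uA; rewrite !finset.inE uA.
  by have [//|uv] := eqVneq u v; apply: EE'; rewrite eq_sym.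
apply: (leq_trans (subset_leq_card sub)); rewrite cardsU1 -add1n.
by rewrite leq_add ?leq_b1// cardsU leq_subr.
Qed.

Lemma is_cliqueU1 E B v : is_clique E B ->
  (forall u, u \in B -> [set v; u]%SET \in E) -> is_clique E (v |: B)%SET.
Proof.
move=> clB vE; apply/forall_inP => x /setU1P[->|xB];
  apply/forall_inP => y /setU1P[->|yB]; apply/implyP => xy.
- by rewrite eqxx in xy.
- exact: vE.
- by rewrite finset.setUC; exact: vE.
- by move/forall_inP/(_ _ xB)/forall_inP/(_ _ yB)/implyP/(_ xy) : clB.
Qed.

Lemma card_cliques_in_nbhd E A v i : v \in A ->
  (#|cliques_in E (nbhd_in E A v) i| <=
   #|[set C in cliques_in E A i.+1 | v \in C]%SET|)%N.
Proof.
move=> vA; set S := cliques_in _ _ i.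
have vS B : B \in S -> v \notin B.
  rewrite finset.inE => /and3P[/fintype.subsetP BN _ _]; apply/negP => /BN.
  by rewrite finset.inE eqxx andbF.
have setU1_inj : {in S &, injective (fun B => v |: B)%SET}.
  move=> B C /vS vB /vS vC BC.
  by rewrite -(finset.setU1K vB) BC finset.setU1K.
rewrite -(card_in_imset setU1_inj); apply/subset_leq_card/fintype.subsetP => C.
case/imsetP => B BS ->; have vB := vS _ BS.
move: BS; rewrite !finset.inE eqxx /= andbT => /and3P[BN /eqP cB clB].
apply/and3P; split; last 1 first.
- apply: is_cliqueU1 clB _ => u /(fintype.subsetP BN).
  by rewrite finset.inE => /and3P[].
- rewrite finset.subUset finset.sub1set vA.
  exact: fintype.subset_trans BN (nbhd_in_sub _ _ _).
- by rewrite cardsU1 vB cB.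
Qed.

Lemma sum_card_cliques_in_nbhd E A i :
  (\sum_(v in A) #|cliques_in E (nbhd_in E A v) i| <=
   i.+1 * #|cliques_in E A i.+1|)%N.
Proof.
apply: (@leq_trans (\sum_(v in A)
          #|[set C in cliques_in E A i.+1 | v \in C]%SET|)%N).
  by apply: leq_sum => v; exact: card_cliques_in_nbhd.
under eq_bigr do rewrite -sum1dep_card big_mkcondr /=.
rewrite exchange_big /= mulnC -sum_nat_const.
apply: leq_sum => C; rewrite finset.inE => /and3P[CA /eqP cC _].
rewrite -big_mkcondr /= sum1dep_card -cC; apply: subset_leq_card.
by apply/fintype.subsetP => x; rewrite !finset.inE => /andP[].
Qed.

End Cliques.

Section CliqueDensity.
Variables (R : realFieldType) (T : finType).
Implicit Types (E : {set {set T}}) (A B S : {set T}) (c p q : R).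

Lemma card_cliques_in_ge E A S i (a : R) : S \subset A ->
  {in S, forall v, a <= #|cliques_in E (nbhd_in E A v) i|%:R} ->
  a * #|S|%:R <= i.+1%:R * #|cliques_in E A i.+1|%:R.
Proof.
move=> SA many; rewrite mulr_natr -sumr_const.
apply: (le_trans (ler_sum _ many)); rewrite -natr_sum -natrM ler_nat.
apply: leq_trans (sum_card_cliques_in_nbhd E A i).
rewrite [leqRHS](bigID (mem S)) /=.
rewrite [X in (_ <= X + _)%N](eq_bigl (mem S)) ?leq_addr// => v.
by rewrite andb_idl// => /(fintype.subsetP SA).
Qed.

(* In a random graph of edge density [p], [c] is about [p ^ 'C(i, 2)]. *)
Definition clique_dense c E A i : Prop :=
  c * #|A|%:R ^+ i / i`!%:R <= #|cliques_in E A i|%:R.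

Definition ramsey_dense c E E' A i j : Prop :=
  clique_dense c E A i \/ clique_dense c E' A j.

Lemma ramsey_denseC c E E' A i j :
  ramsey_dense c E E' A i j -> ramsey_dense c E' E A j i.
Proof. by case; [right|left]. Qed.

Lemma clique_dense0 c E A : c <= 1 -> clique_dense c E A 0.
Proof.
by move=> c1; rewrite /clique_dense card_cliques_in0 expr0 fact0 divr1 mulr1.
Qed.

Lemma clique_dense_le c c' E A i :
  c' <= c -> clique_dense c E A i -> clique_dense c' E A i.
Proof. by move=> c'c; apply: le_trans; rewrite -!mulrA ler_wpM2r. Qed.

Lemma ramsey_dense_le c c' E E' A i j :
  c' <= c -> ramsey_dense c E E' A i j -> ramsey_dense c' E E' A i j.
Proof.
by move=> c'c; case=> /(clique_dense_le c'c); [left|right].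
Qed.

Lemma clique_dense_subset c p E A B j : 0 <= c -> 0 <= p -> B \subset A ->
  p * #|A|%:R <= #|B|%:R -> clique_dense c E B j ->
  clique_dense (c * p ^+ j) E A j.
Proof.
move=> c0 p0 BA pAB cB.
apply: (@le_trans _ _ #|cliques_in E B j|%:R); last first.
  by rewrite ler_nat leq_card_cliques_in.
apply: le_trans cB; rewrite ler_wpM2r ?invr_ge0// -mulrA -exprMn ler_wpM2l//.
by rewrite lerXn2r ?nnegrE ?mulr_ge0.
Qed.

Lemma clique_dense_of_nbhds c p E A S i : 0 <= c -> 0 <= p -> S \subset A ->
  #|A|%:R / 2 <= #|S|%:R :> R ->
  {in S, forall v, p * #|A|%:R <= #|nbhd_in E A v|%:R} ->
  {in S, forall v, clique_dense c E (nbhd_in E A v) i} ->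
  clique_dense (2^-1 * c * p ^+ i) E A i.+1.
Proof.
move=> c0 p0 SA AS pS cS; set x : R := #|A|%:R.
pose a := c * (p * x) ^+ i / i`!%:R.
have a0 : 0 <= a by rewrite divr_ge0// mulr_ge0// exprn_ge0// mulr_ge0.
have aS : {in S, forall v, a <= #|cliques_in E (nbhd_in E A v) i|%:R}.
  move=> v vS; apply: le_trans (cS v vS); rewrite ler_wpM2r ?invr_ge0//.
  by rewrite ler_wpM2l// lerXn2r ?nnegrE ?mulr_ge0// pS.
have := le_trans (ler_wpM2l a0 AS) (card_cliques_in_ge SA aS).
rewrite -ler_pdivrMl ?ltr0n//; apply: le_trans; rewrite -/x.
suff -> : 2^-1 * c * p ^+ i * x ^+ i.+1 / i.+1`!%:R =
  i.+1%:R^-1 * (a * (x / 2)) by [].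
rewrite /a factS natrM exprS exprMn.
by field; rewrite nat1r !pnatr_eq0 -lt0n fact_gt0.
Qed.

Lemma ramsey_dense_of_nbhds c p m E E' A S i j : 0 <= c -> 0 <= p <= 1 ->
  S \subset A -> #|A|%:R / 2 <= #|S|%:R :> R -> (i <= m)%N -> (j <= m)%N ->
  {in S, forall v, p * #|A|%:R <= #|nbhd_in E A v|%:R} ->
  {in S, forall v, ramsey_dense c E E' (nbhd_in E A v) i j} ->
  ramsey_dense (2^-1 * c * p ^+ m) E E' A i.+1 j.
Proof.
move=> c0 /andP[p0 p1] SA AS im jm pS cS.
have [[v [vS Ev]]|noE'] := pselect (exists v, v \in S /\
    clique_dense c E' (nbhd_in E A v) j).
  right; apply: clique_dense_le (clique_dense_subset c0 p0 _ (pS v vS) Ev).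
    have pmj : c * p ^+ m <= c * p ^+ j by rewrite ler_wpM2l// ler_wiXn2l.
    by have := mulr_ge0 c0 (exprn_ge0 m p0); lra.
  exact: nbhd_in_sub.
left; apply: clique_dense_le (clique_dense_of_nbhds c0 p0 SA AS pS _).
  by rewrite ler_wpM2l ?mulr_ge0 ?invr_ge0// ler_wiXn2l.
by move=> v vS; case: (cS v vS) => // Ev; case: noE'; exists v.
Qed.

Lemma half_large_nbhds p q E E' A : edge_cover E E' ->
  1 <= (1 - p - q) * #|A|%:R ->
  exists S : {set T}, [/\ S \subset A, #|A|%:R / 2 <= #|S|%:R :> R &
    {in S, forall v, p * #|A|%:R <= #|nbhd_in E A v|%:R} \/
    {in S, forall v, q * #|A|%:R <= #|nbhd_in E' A v|%:R}].
Proof.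
move=> EE' A_large; set x : R := #|A|%:R in A_large *.
pose S := [set v in A | p * x <= #|nbhd_in E A v|%:R]%SET.
have SA : S \subset A.
  by apply/fintype.subsetP => v; rewrite finset.inE => /andP[].
have [S_large|S_small] := leP (x / 2) #|S|%:R.
  by exists S; split=> //; left=> v; rewrite finset.inE => /andP[].
exists (A :\: S)%SET; split; first exact: finset.subsetDl.
  rewrite cardsD (finset.setIidPr SA) natrB ?subset_leq_card//.
  by rewrite -/x; lra.
right=> v; rewrite !finset.inE => /andP[+ vA]; rewrite vA /= -ltNge => vp.
have := card_nbhd_in_cover A v EE'; rewrite -(ler_nat R) -natr1 natrD -/x; lra.
Qed.

End CliqueDensity.

Section RamseyRecursion.
Variable R : realType.
Implicit Type M : nat -> nat -> R.

Definition ramsey_recursive M : Prop :=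
  (forall i j, 0 < M i j <= 1) /\
  forall i j, exists p q : R, [/\ 0 < p, 0 < q, p + q < 1,
    M i.+1 j.+1 <= 2^-1 * M i j.+1 * p ^+ (maxn i j).+1 &
    M i.+1 j.+1 <= 2^-1 * M i.+1 j * q ^+ (maxn i j).+1].

Definition eventually_ramsey_dense c i j : Prop :=
  \forall n \near \oo, forall (T : finType) (E E' : {set {set T}})
    (A : {set T}), edge_cover E E' -> (n <= #|A|)%N ->
  ramsey_dense (c : R) E E' A i j.

Lemma eventually_ramsey_dense_rec (c c' c'' p q : R) i j :
  0 <= c -> 0 <= c' -> 0 < p -> 0 < q -> p + q < 1 ->
  c'' <= 2^-1 * c * p ^+ (maxn i j).+1 ->
  c'' <= 2^-1 * c' * q ^+ (maxn i j).+1 ->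
  eventually_ramsey_dense c i j.+1 -> eventually_ramsey_dense c' i.+1 j ->
  eventually_ramsey_dense c'' i.+1 j.+1.
Proof.
move=> c0 c'0 p0 q0 pq c''c c''c' [N _ dense] [N' _ dense'].
have pq0 : 0 < 1 - p - q by lra.
near=> n => T E E' A EE' nA.
have A_large (r : R) : r <= n%:R -> r <= #|A|%:R.
  by move=> rn; rewrite (le_trans rn)// ler_nat.
have pN : N%:R <= p * #|A|%:R.
  by rewrite -ler_pdivrMl// A_large//; near: n; exact: nbhs_infty_ger.
have qN' : N'%:R <= q * #|A|%:R.
  by rewrite -ler_pdivrMl// A_large//; near: n; exact: nbhs_infty_ger.
have pqA : 1 <= (1 - p - q) * #|A|%:R.
  by rewrite -ler_pdivrMl// A_large//; near: n; exact: nbhs_infty_ger.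
have [S [SA AS [pS|qS]]] := half_large_nbhds EE' pqA.
- apply: ramsey_dense_le c''c (ramsey_dense_of_nbhds c0 _ SA AS _ _ pS _).
  + by apply/andP; split; lra.
  + by rewrite leqW// leq_maxl.
  + by rewrite ltnS leq_maxr.
  + move=> v vS; apply: dense (leqnn _) _ _ _ _ EE' _.
    by rewrite -(ler_nat R) (le_trans pN)// pS.
- apply: ramsey_denseC.
  apply: ramsey_dense_le c''c' (ramsey_dense_of_nbhds c'0 _ SA AS _ _ qS _).
  + by apply/andP; split; lra.
  + by rewrite leqW// leq_maxr.
  + by rewrite ltnS leq_maxl.
  + move=> v vS; apply: ramsey_denseC; apply: dense' (leqnn _) _ _ _ _ EE' _.
    by rewrite -(ler_nat R) (le_trans qN')// qS.
Unshelve. all: by end_near. Qed.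

Lemma ramsey_recursive_eventually_dense M : ramsey_recursive M ->
  forall i j, eventually_ramsey_dense (M i j) i j.
Proof.
move=> [M01 Mpq].
have M_ge0 i j : 0 <= M i j by have /andP[/ltW] := M01 i j.
have M_le1 i j : M i j <= 1 by have /andP[] := M01 i j.
elim=> [|i IHi] j.
  by apply: nearW => n T E E' A _ _; left; exact: clique_dense0.
elim: j => [|j IHj].
  by apply: nearW => n T E E' A _ _; right; exact: clique_dense0.
have [p [q [p0 q0 pq Mp Mq]]] := Mpq i j.
exact: eventually_ramsey_dense_rec Mp Mq (IHi j.+1) IHj.
Qed.

End RamseyRecursion.

Section VertexDeletion.
Variable n : nat.
Implicit Types (E : {set {set 'I_n.+1}}) (v : 'I_n.+1) (t : nat).

Definition delete_vertex v E : {set {set 'I_n}} :=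
  [set e : {set 'I_n} | finset.imset (lift v) (mem e) \in E]%SET.

Lemma delete_vertex_simple v E :
  simple_graph E -> simple_graph (delete_vertex v E).
Proof.
move=> /forall_inP sE; apply/forall_inP => e; rewrite finset.inE => /sE.
by rewrite card_imset//; exact: lift_inj.
Qed.

Lemma delete_vertex_compl v E :
  delete_vertex v (graph_compl E) = graph_compl (delete_vertex v E).
Proof.
by apply/finset.setP => e; rewrite !finset.inE card_imset//; exact: lift_inj.
Qed.

Lemma num_cliques_delete_vertex v E t :
  (num_cliques t (delete_vertex v E) <=
   #|[set B : {set 'I_n.+1} | ((#|B| == t) && is_clique E B) &&
                              (v \notin B)]%SET|)%N.
Proof.
rewrite /num_cliques -(card_imset _ (imset_inj (@lift_inj _ v))).
apply/subset_leq_card/fintype.subsetP => C /imsetP[B + ->].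
rewrite !finset.inE card_imset; last exact: lift_inj.
move=> /andP[-> /= clB]; apply/andP; split; last first.
  by apply/imsetP => -[u _ /eqP]; rewrite (negPf (neq_lift _ _)).
apply/forall_inP => _ /imsetP[x xB ->].
apply/forall_inP => _ /imsetP[y yB ->]; apply/implyP => xy.
move/forall_inP/(_ _ xB)/forall_inP/(_ _ yB)/implyP : clB.
rewrite finset.inE imsetU1 imset_set1; apply.
by apply: contra_neq xy => ->.
Qed.

Lemma sum_num_cliques_delete_vertex E t :
  (\sum_v num_cliques t (delete_vertex v E) <= (n.+1 - t) * num_cliques t E)%N.
Proof.
apply: leq_trans.
  by apply: leq_sum => v _; exact: num_cliques_delete_vertex.
under eq_bigr do rewrite -sum1dep_card big_mkcondr /=.
rewrite exchange_big /= mulnC -sum_nat_const.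
under [leqRHS]eq_bigl do rewrite finset.inE.
apply: leq_sum => B /andP[/eqP cB _]; rewrite -big_mkcond /= sum1dep_card.
have -> : (n.+1 - t)%N = #|(~: B)%SET|.
  by rewrite -cB cardsCs card_ord finset.setCK.
by apply: subset_leq_card; apply/fintype.subsetP => u; rewrite !finset.inE.
Qed.

Lemma min_mono_cliques_delete_vertex t :
  (n.+1 * min_mono_cliques t n <= (n.+1 - t) * min_mono_cliques t n.+1)%N.
Proof.
have [E [sE <-]] := min_mono_cliques_ex t n.+1.
rewrite -[X in (X * _ <= _)%N]card_ord -sum_nat_const mulnDr.
apply: (@leq_trans (\sum_v (num_cliques t (delete_vertex v E) +
   num_cliques t (delete_vertex v (graph_compl E))))%N); last first.
  by rewrite big_split leq_add ?sum_num_cliques_delete_vertex.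
apply: leq_sum => v _; rewrite delete_vertex_compl.
exact/min_mono_cliques_le/delete_vertex_simple.
Qed.

End VertexDeletion.

Section RamseyMultiplicity.
Variable R : realType.
Implicit Types (t n : nat) (c : R).

Definition mono_density t n : R := (min_mono_cliques t n)%:R / 'C(n, t)%:R.

Lemma nondecreasing_mono_density t :
  {homo mono_density t : m n / (m <= n)%N >-> m <= n}.
Proof.
apply/nondecreasing_seqP => n; have [nt|tn] := ltnP n t.
  by rewrite [mono_density t n]/mono_density bin_small// invr0 mulr0 divr_ge0.
have bin_gt0 k : (t <= k)%N -> 0 < 'C(k, t)%:R :> R by rewrite ltr0n bin_gt0.
rewrite ler_pdivrMr ?bin_gt0// mulrAC ler_pdivlMr ?bin_gt0 ?leqW//.
rewrite -!natrM ler_nat -(@leq_pmul2l n.+1)//.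
rewrite mulnA [leqRHS]mulnCA [(n.+1 * 'C(n, t))%N](mul_bin_down n.+1 t).
rewrite mulnA [(_ * (_ - _))%N]mulnC leq_mul2r min_mono_cliques_delete_vertex.
by rewrite orbT.
Qed.

Lemma num_cliques_le_bin (T : finType) (E : {set {set T}}) t :
  (num_cliques t E <= 'C(#|T|, t))%N.
Proof.
rewrite -card_draws; apply/subset_leq_card/fintype.subsetP => B.
by rewrite !finset.inE => /andP[].
Qed.

Lemma mono_density_le2 t n : mono_density t n <= 2.
Proof.
rewrite /mono_density; have [nt|tn] := ltnP n t.
  by rewrite bin_small// invr0 mulr0.
rewrite ler_pdivrMr ?ltr0n ?bin_gt0// -natrM ler_nat mul2n -addnn.
have [E [_ <-]] := min_mono_cliques_ex t n.
by rewrite -{3 4}[n]card_ord leq_add// num_cliques_le_bin.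
Qed.

Lemma is_cvg_mono_density t : cvgn (mono_density t).
Proof.
apply: nondecreasing_is_cvgn; first exact: nondecreasing_mono_density.
by exists 2 => _ [n _ <-]; exact: mono_density_le2.
Qed.

Lemma bin_le_expn_div_fact t n : 'C(n, t)%:R <= n%:R ^+ t / t`!%:R :> R.
Proof.
rewrite ler_pdivlMr ?ltr0n ?fact_gt0// -natrM -natrX ler_nat bin_ffact.
rewrite ffact_prod -[t in leqRHS]card_ord -prod_nat_const.
by apply: leq_prod => i _; exact: leq_subr.
Qed.

Lemma ramsey_mult_const_ge t c : 0 <= c ->
  (\forall n \near \oo, c * n%:R ^+ t / t`!%:R <= (min_mono_cliques t n)%:R) ->
  c <= ramsey_mult_const R t.
Proof.
move=> c0 cn; apply: limr_ge; first exact: is_cvg_mono_density.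
near=> n; have tn : (t <= n)%N by near: n; exact: nbhs_infty_ge.
rewrite ler_pdivlMr ?ltr0n ?bin_gt0//.
apply: (@le_trans _ _ (c * n%:R ^+ t / t`!%:R)); last by near: n.
by rewrite -mulrA ler_wpM2l ?bin_le_expn_div_fact.
Unshelve. all: by end_near. Qed.

Lemma ramsey_recursive_mult_const_ge (M : nat -> nat -> R) t :
  ramsey_recursive M -> M t t <= ramsey_mult_const R t.
Proof.
move=> recM; have /andP[/ltW M0 _] := recM.1 t t.
apply: ramsey_mult_const_ge => //.
have [N _ denseM] := ramsey_recursive_eventually_dense recM t t.
near=> n; have [E [_ <-]] := min_mono_cliques_ex t n.
have : ramsey_dense (M t t) E (graph_compl E) finset.setT t t.
  apply: denseM (leqnn N) _ _ _ _ (@edge_cover_compl _ E) _.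
  by rewrite cardsT card_ord; near: n; exact: nbhs_infty_ge.
rewrite /ramsey_dense /clique_dense cardsT card_ord -!num_cliquesE.
rewrite /mono_cliques natrD; case=> /le_trans; apply; first by rewrite lerDl.
by rewrite lerDr.
Unshelve. all: by end_near. Qed.

Lemma ramsey_mult_const0_ge1 : 1 <= ramsey_mult_const R 0.
Proof.
apply: ramsey_mult_const_ge => //; apply: nearW => n.
have [E [_ <-]] := min_mono_cliques_ex 0 n.
rewrite expr0 fact0 divr1 mulr1 (ler_nat _ 1) /mono_cliques.
by rewrite !num_cliquesE !card_cliques_in0.
Qed.

(* The recursion for [M = exp (- F)], up to its factors [1 / 2]. *)
Definition ramsey_exponent (F : nat -> nat -> R) : Prop :=
  (forall i j, 0 <= F i j) /\
  forall i j, exists u v, [/\ expR (- u) + expR (- v) < 1,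
    (maxn i j).+1%:R * u <= F i.+1 j.+1 - F i j.+1 &
    (maxn i j).+1%:R * v <= F i.+1 j.+1 - F i.+1 j].

Lemma expRN1_lt_half : expR (- 1) < 2^-1 :> R.
Proof.
rewrite expRN ltf_pV2 ?posrE ?expR_gt0//.
exact: expR_gt1Dx (oner_neq0 R).
Qed.

Lemma ramsey_recursive_exponent F : ramsey_exponent F ->
  ramsey_recursive (fun i j => expR (- (F i j + (i + j)%:R))).
Proof.
move=> [F0 Fuv]; split=> [i j|i j].
  by rewrite expR_gt0 -[leRHS]expR0 ler_expR oppr_le0 addr_ge0.
have step k m (x z s : R) : m%:R * s <= x - z ->
    expR (- (x + k.+1%:R)) <= 2^-1 * expR (- (z + k%:R)) * expR (- s) ^+ m.
  move=> xz; rewrite -expRM_natl mulrAC -mulrA -expRD.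
  apply: le_trans (ler_wpM2r (expR_ge0 _) (ltW expRN1_lt_half)).
  by rewrite -expRD ler_expR -nat1r; lra.
have [u [v [uv Fu Fv]]] := Fuv i j; exists (expR (- u)), (expR (- v)).
split; rewrite ?expR_gt0//.
- by rewrite addSn; exact: step.
- by rewrite addnS; exact: step.
Qed.

Lemma ramsey_exponent_mult_const_ge F t : ramsey_exponent F ->
  expR (- (F t t + (t + t)%:R)) <= ramsey_mult_const R t.
Proof. by move/ramsey_recursive_exponent/ramsey_recursive_mult_const_ge. Qed.

Lemma ramsey_exponent_sqr : ramsey_exponent (fun i j => (i + j)%:R ^+ 2).
Proof.
split=> [i j|i j]; first exact: sqr_ge0.
exists 1, 1; split; first by have := expRN1_lt_half; lra.
all: rewrite mulr1 -!natrX -natrB ?ler_nat ?leq_sqr; lia.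
Qed.

Lemma ramsey_mult_const_gt0 t : 0 < ramsey_mult_const R t.
Proof.
by apply: lt_le_trans (ramsey_exponent_mult_const_ge t ramsey_exponent_sqr);
  exact: expR_gt0.
Qed.

End RamseyMultiplicity.

Lemma natr_ratio_itv (R : realFieldType) (a b : nat) :
  (b <= a)%N -> b%:R / a%:R \in `[(0 : R), 1].
Proof.
rewrite in_itv/=; case: a => [|a] ba; first by rewrite invr0 mulr0 lexx ler01.
by rewrite divr_ge0//= ler_pdivrMr ?ltr0n// mul1r ler_nat.
Qed.

Section WindowMean.
Variables (R : realType) (width : nat).
Implicit Types (g : nat -> nat -> R) (i j : nat).

Definition window_mean g i j : R :=
  arithmetic_mean (fun k => g (i.+1 + k)%N (j.+1 + (width - k))%N) width.

Lemma window_mean_transpose g i j :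
  window_mean (fun a b => g b a) i j = window_mean g j i.
Proof.
rewrite /window_mean -[RHS]arithmetic_mean_rev !arithmetic_meanE.
by congr (_ * _); apply: eq_bigr => k _; rewrite subKn// -ltnS.
Qed.

(* An antidiagonal window meets the diagonal at most once. *)
Lemma window_mean_diagonal i j :
  window_mean (fun a b => (a == b)%:R) i j <= width.+1%:R^-1.
Proof.
rewrite /window_mean arithmetic_meanE ler_piMr ?invr_ge0// -natr_sum lern1.
pose hit (k : 'I_width.+1) := (i.+1 + k == j.+1 + (width - k))%N.
have [k hitk|no_hit] := pickP hit; last first.
  by rewrite big1// => k _; move: (no_hit k); rewrite /hit => ->.
rewrite (bigD1 k)//= big1 ?addn0 ?leq_b1// => l lk.
apply/eqP; rewrite eqb0; apply: contra lk => hitl; apply/eqP/val_inj => /=.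
by move: hitk hitl (ltn_ord k) (ltn_ord l); rewrite /hit; lia.
Qed.

Lemma expRN_window_mean_le g i j :
  expR (- window_mean g i j) <= window_mean (fun a b => expR (- g a b)) i j.
Proof.
by rewrite /window_mean -arithmetic_meanN; exact: expR_arithmetic_mean_le.
Qed.

End WindowMean.

(* On [b <= a], [F a b = a ^ 2 * f (b / a)] has partial derivatives
   [a * slope_max (b / a)] and [a * slope_min (b / a)], where [slope_min] is the
   slope of [f] and [slope_max] comes from Euler's relation for the homogeneous
   function [F]. *)
Section Potential.
Variables (R : realType) (f slope_min : R -> R).

Definition slope_max (s : R) : R := 2 * f s - s * slope_min s.

Hypotheses
  (slope_max_ge0 : {in `[0, 1], forall s, 0 <= slope_max s})
  (slope_min_ge0 : {in `[0, 1], forall s, 0 <= slope_min s})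
  (f_le_tangent :
    {in `[0, 1] &, forall s z, f z <= f s + slope_min s * (z - s)})
  (slopes_admissible : {in `[0, 1], forall s,
    expR (- slope_max s) + expR (- slope_min s) <= 1}).

Definition potential (a b : nat) : R :=
  (maxn a b)%:R ^+ 2 * f ((minn a b)%:R / (maxn a b)%:R).

Lemma potentialC a b : potential a b = potential b a.
Proof. by rewrite /potential maxnC minnC. Qed.

Lemma profile_ge0 s : s \in `[0, 1] -> 0 <= f s.
Proof.
move=> s01; have := slope_max_ge0 s01; rewrite /slope_max.
have s0 : 0 <= s by rewrite (itvP s01).
by have := mulr_ge0 s0 (slope_min_ge0 s01); lra.
Qed.

Lemma potential_ge0 a b : 0 <= potential a b.
Proof. by rewrite mulr_ge0 ?sqr_ge0// profile_ge0// natr_ratio_itv//; lia. Qed.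

Lemma potential_le a b : potential a b <= (maxn a b)%:R ^+ 2 * f 1.
Proof.
have one01 : (1 : R) \in `[0, 1] by rewrite bound_itvE.
have s01 : (minn a b)%:R / (maxn a b)%:R \in `[(0 : R), 1].
  by apply: natr_ratio_itv; lia.
rewrite ler_wpM2l ?sqr_ge0// (le_trans (f_le_tangent one01 s01))//.
by rewrite gerDl mulr_ge0_le0 ?slope_min_ge0// subr_le0 (itvP s01).
Qed.

Lemma potential_diff_max (a b : nat) : (0 < a)%N -> (b <= a)%N ->
  a%:R * slope_max (b%:R / a.+1%:R) <= potential a.+1 b - potential a b.
Proof.
move=> a0 ba; rewrite /potential (maxn_idPl (leqW ba)) (minn_idPr (leqW ba)).
rewrite (maxn_idPl ba) (minn_idPr ba).
have s01 := natr_ratio_itv R (leqW ba); have z01 := natr_ratio_itv R ba.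
have := f_le_tangent s01 z01; have := slope_max_ge0 s01.
rewrite /slope_max; have := slope_min_ge0 s01.
have s0 : 0 <= b%:R / a.+1%:R :> R by rewrite (itvP s01).
have x0 : 0 < a%:R :> R by rewrite ltr0n.
rewrite -nat1r in s0 *.
have -> : b%:R / a%:R = b%:R / (1 + a%:R) + b%:R / (1 + a%:R) / a%:R :> R.
  by field; rewrite !gt_eqF// ltr_pwDl.
set s := b%:R / (1 + a%:R) in s0 *; set x := a%:R in x0 *.
rewrite [s + _]addrC addrK.
set q := slope_min s; set w := f (_ + _) => q0 p0 fw.
have : x ^+ 2 * w <= x ^+ 2 * (f s + q * (s / x)) by rewrite ler_wpM2l ?sqr_ge0.
have -> : x ^+ 2 * (f s + q * (s / x)) = x ^+ 2 * f s + x * (s * q).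
  by field; rewrite gt_eqF.
have fs0 : 0 <= f s by have := mulr_ge0 s0 q0; lra.
lra.
Qed.

Lemma potential_diff_min (a b : nat) : (b < a)%N ->
  a%:R * slope_min (b.+1%:R / a%:R) <= potential a b.+1 - potential a b.
Proof.
move=> ba; have ba' := ltnW ba; rewrite /potential.
rewrite (maxn_idPl ba) (minn_idPr ba) (maxn_idPl ba') (minn_idPr ba').
have x0 : 0 < a%:R :> R by rewrite ltr0n (leq_ltn_trans _ ba).
have := f_le_tangent (natr_ratio_itv R ba) (natr_ratio_itv R ba').
have -> : b%:R / a%:R - b.+1%:R / a%:R = - a%:R^-1 :> R.
  by rewrite -nat1r; field; rewrite gt_eqF.
move/(ler_wpM2l (sqr_ge0 a%:R)); set q := slope_min _.
rewrite mulrDr mulrN mulrN.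
have -> : a%:R ^+ 2 * (q / a%:R) = a%:R * q by field; rewrite gt_eqF.
lra.
Qed.

(* On the diagonal both backward slopes of [potential] are about [slope_min 1],
   which need not be admissible; [0] is merely a lower bound for them. *)
Definition slope (a b : nat) : R :=
  if (b < a)%N then slope_max (b%:R / a%:R)
  else if (a < b)%N then slope_min (a%:R / b%:R) else 0.

Lemma slope_ge0 a b : 0 <= slope a b.
Proof.
rewrite /slope; case: ltngtP => // [ba|ab].
- exact/slope_max_ge0/natr_ratio_itv/ltnW.
- exact/slope_min_ge0/natr_ratio_itv/ltnW.
Qed.

Lemma expR_slope_le a b :
  expR (- slope a b) + expR (- slope b a) <= 1 + (a == b)%:R.
Proof.
rewrite /slope; case: ltngtP => [ba|ab|_].
- by rewrite addr0 slopes_admissible// natr_ratio_itv// ltnW.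
- by rewrite addr0 addrC slopes_admissible// natr_ratio_itv// ltnW.
- by rewrite oppr0 expR0.
Qed.

Lemma potential_diff_ge (a b m : nat) : (0 < a)%N -> (m < maxn a.+1 b)%N ->
  m%:R * slope a.+1 b <= potential a.+1 b - potential a b.
Proof.
move=> a0 mab.
have weaken x r : (m <= x)%N -> x%:R * slope a.+1 b <= r ->
    m%:R * slope a.+1 b <= r.
  by move=> mx; apply: le_trans; rewrite ler_wpM2r ?slope_ge0 ?ler_nat.
case: (ltngtP b a.+1) => [ba|ab|->].
- apply: (weaken a); first by move: mab; rewrite (maxn_idPl (ltnW ba)).
  by rewrite /slope ba potential_diff_max.
- apply: (weaken b); first by move: mab; rewrite (maxn_idPr (ltnW ab)) => /ltnW.
  rewrite /slope ltnNge (ltnW ab)/= ab potentialC (potentialC a).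
  exact/potential_diff_min/ltnW.
- rewrite /slope ltnn mulr0 (potentialC a).
  apply: le_trans (potential_diff_min (ltnSn a)).
  by rewrite mulr_ge0// slope_min_ge0// natr_ratio_itv.
Qed.

Lemma window_mean_potential_diag_le width t :
  window_mean width potential t t <= (t + width.+1)%:R ^+ 2 * f 1.
Proof.
rewrite -[leRHS](arithmetic_mean_cst _ width).
apply: ler_arithmetic_mean => k kw; apply: le_trans (potential_le _ _) _.
rewrite ler_wpM2r ?profile_ge0 ?bound_itvE//.
by rewrite -!natrX ler_nat leq_sqr; lia.
Qed.

Section Smoothing.
Variables (width : nat) (delta : R).
Hypothesis delta_gt0 : 0 < delta.

(* Averaging over the window removes the kink of [potential] along the diagonal;
   [delta] pays for the window's hit on the diagonal. *)
Definition smooth_potential (i j : nat) : R :=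
  window_mean width potential i j + delta * (i + j)%:R ^+ 2.

Lemma smooth_potentialC i j : smooth_potential i j = smooth_potential j i.
Proof.
rewrite /smooth_potential addnC -window_mean_transpose; congr (_ + _).
by congr window_mean; apply/funext => a; apply/funext => b; rewrite potentialC.
Qed.

Lemma smooth_potential_ge0 i j : 0 <= smooth_potential i j.
Proof.
apply: addr_ge0; last by rewrite mulr_ge0 ?sqr_ge0 ?ltW.
rewrite -[leLHS](arithmetic_mean_cst _ width).
by apply: ler_arithmetic_mean => k _; exact: potential_ge0.
Qed.

Lemma smooth_potential_diff_ge i j :
  (maxn i j).+1%:R * (delta + window_mean width slope i.+1 j.+1) <=
  smooth_potential i.+1 j.+1 - smooth_potential i j.+1.
Proof.
set m := (maxn i j).+1.
have mean_diff : m%:R * window_mean width slope i.+1 j.+1 <=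
    window_mean width potential i.+1 j.+1 - window_mean width potential i j.+1.
  rewrite /window_mean -arithmetic_meanZ -arithmetic_meanN -arithmetic_meanD.
  apply: ler_arithmetic_mean => k _; rewrite [(i.+2 + k)%N]addSn.
  by apply: potential_diff_ge => //; rewrite /m; lia.
have square_diff :
    m%:R * delta <= delta * (i.+1 + j.+1)%:R ^+ 2 - delta * (i + j.+1)%:R ^+ 2.
  rewrite -mulrBr mulrC ler_wpM2l ?(ltW delta_gt0)// -!natrX -natrB ?ler_nat.
    by rewrite /m; nia.
  by rewrite leq_sqr; lia.
by rewrite mulrDr addrC /smooth_potential opprD addrACA; exact: lerD.
Qed.

Hypothesis width_delta : width.+1%:R^-1 < delta.

Lemma window_mean_slope_admissible i j :
  expR (- (delta + window_mean width slope i j)) +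
  expR (- (delta + window_mean width slope j i)) < 1.
Proof.
rewrite !opprD !expRD -mulrDr expRN ltr_pdivrMl ?expR_gt0// mulr1.
rewrite -[window_mean width slope j i]window_mean_transpose.
apply: le_lt_trans; first by apply: lerD; exact: expRN_window_mean_le.
rewrite /window_mean -arithmetic_meanD.
apply: (@le_lt_trans _ _ (1 + window_mean width (fun a b => (a == b)%:R) i j)).
  rewrite -[X in _ <= X + _](arithmetic_mean_cst _ width) -arithmetic_meanD.
  by apply: ler_arithmetic_mean => k _; exact: expR_slope_le.
apply: lt_le_trans (expR_ge1Dx delta); rewrite ltrD2l.
exact: le_lt_trans (window_mean_diagonal _ width i j) width_delta.
Qed.

Lemma ramsey_exponent_smooth_potential : ramsey_exponent smooth_potential.
Proof.
split=> [i j|i j]; first exact: smooth_potential_ge0.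
exists (delta + window_mean width slope i.+1 j.+1).
exists (delta + window_mean width slope j.+1 i.+1).
split; [exact: window_mean_slope_admissible|exact: smooth_potential_diff_ge|].
rewrite maxnC smooth_potentialC (smooth_potentialC i.+1).
exact: smooth_potential_diff_ge.
Qed.

End Smoothing.

Lemma ramsey_mult_const_eventually_ge (l : R) : f 1 < l ->
  \forall t \near \oo, expR (- (l * t%:R ^+ 2)) <= ramsey_mult_const R t.
Proof.
move=> fl; pose delta := (l - f 1) / 8.
have delta0 : 0 < delta by rewrite divr_gt0// subr_gt0.
pose width := Num.truncn delta^-1.
have width_delta : width.+1%:R^-1 < delta.
  by rewrite invf_plt ?posrE// truncnS_gt.
pose K : R := width.+1%:R.
have fdl : f 1 + 4 * delta < l by rewrite /delta; lra.
near=> t.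
apply: le_trans (ramsey_exponent_mult_const_ge t
  (ramsey_exponent_smooth_potential delta0 width_delta)).
rewrite ler_expR lerN2.
have quadratic : (f 1 + 4 * delta) * t%:R ^+ 2 + (2 * K * f 1 + 2) * t%:R +
    K ^+ 2 * f 1 <= l * t%:R ^+ 2.
  by near: t; exact: quadratic_eventually_le.
apply: le_trans quadratic; rewrite /smooth_potential.
have := window_mean_potential_diag_le width t; rewrite !natrD -/K; lra.
Unshelve. all: by end_near. Qed.

End Potential.

Section ODE.
Variable R : realType.
Implicit Types (x u v : R) (y : R -> R).

Definition ode_rhs x u : R := ln u * (u * (1 - u) / (x - (1 + x) * u)).

Lemma ode_rhs_gt0 x u : 0 < u < 1 -> x - (1 + x) * u < 0 -> 0 < ode_rhs x u.
Proof.
move=> /andP[u0 u1] den; rewrite /ode_rhs nmulr_rgt0 ?ln_lt0 ?u0//.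
by rewrite nmulr_llt0 ?invr_lt0// mulr_gt0// subr_gt0.
Qed.

Lemma ode_rhs_decreasing x u v : 0 <= x -> 0 < u -> u < v -> v < 1 ->
  x - (1 + x) * u < 0 -> ode_rhs x v < ode_rhs x u.
Proof.
move=> x0 u0 uv v1 den_u; have v0 : 0 < v by exact: lt_trans uv.
have den_v : x - (1 + x) * v < 0 by nra.
have rhsE w : ode_rhs x w = (- ln w) * (1 - w) * (w / ((1 + x) * w - x)).
  by rewrite /ode_rhs -[_ * w - x]opprB invrN; ring.
have ln_v0 : 0 < - ln v by rewrite oppr_gt0 ln_lt0// v0.
have ln_uv : - ln v < - ln u by rewrite ltrN2 ltr_ln ?posrE.
have ratio_v0 : 0 < v / ((1 + x) * v - x) by rewrite divr_gt0//; lra.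
have ratio_uv : v / ((1 + x) * v - x) <= u / ((1 + x) * u - x).
  by rewrite ler_pdivlMr; [rewrite mulrAC ler_pdivrMr; nra|lra].
rewrite !rhsE (@lt_le_trans _ _ (- ln u * (1 - u) * (v / ((1 + x) * v - x))))//.
  by rewrite ltr_pM2r//; nra.
by rewrite ler_wpM2l// mulr_ge0//; lra.
Qed.

Section Solution.
Variable y : R -> R.
Hypotheses (y_ode : solves_ode y) (y0_itv : 0 < y 0 < 1).

Lemma ode_gt0 : {in `[0, 1], forall x, 0 < y x}.
Proof. by move=> x /y_ode[]. Qed.

Lemma ode_has_deriv_within :
  {in `[0, 1], forall x, has_deriv_within `[0, 1] y x (ode_rhs x (y x))}.
Proof. by move=> x /y_ode[]. Qed.

Lemma ode_continuous : {within `[0, 1], continuous y}.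
Proof.
apply: has_deriv_within_continuous => x x01.
by exists (ode_rhs x (y x)); exact: ode_has_deriv_within.
Qed.

Lemma ode_is_derive :
  {in `]0, 1[, forall x, is_derive x (1 : R) y (ode_rhs x (y x))}.
Proof.
move=> x x01; apply: (@has_deriv_within_is_derive _ `[0, 1]).
  by apply: filterS (near_in_itvoo x01) => z; exact: subset_itv_oo_cc.
exact/ode_has_deriv_within/subset_itv_oo_cc.
Qed.

Lemma ode_denom_continuous :
  {within `[0, 1], continuous (fun x => (1 + x) * y x - x)}.
Proof.
have cid : {within `[0, 1], continuous (@id R)} := @within_continuous_id _ _.
have c1 : {within `[0, 1], continuous (cst 1 + @id R)}.
  by apply: within_continuousD cid; exact: within_continuous_cst.
exact: within_continuousB (within_continuousM c1 ode_continuous) cid.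
Qed.

Lemma ode_denom_lt0 : {in `[0, 1], forall x, x - (1 + x) * y x < 0}.
Proof.
move=> x x01; rewrite -oppr_gt0 opprB.
apply: within_continuous_neq0_gt0 ode_denom_continuous _ _ x x01.
- by move=> z /y_ode[_ + _]; rewrite -oppr_eq0 opprB.
- by rewrite addr0 mul1r subr0; case/andP: y0_itv.
Qed.

(* [1 - y] solves the linear equation [z' = k z]. *)
Lemma ode_lt1 : {in `[0, 1], forall x, y x < 1}.
Proof.
move=> x x01; rewrite -subr_gt0.
pose k z := ln (y z) * y z * ((1 + z) * y z - z)^-1.
have ck : {within `[0, 1], continuous k}.
  apply: within_continuousM; last first.
    apply: within_continuousV ode_denom_continuous _ => z /ode_denom_lt0.
    by rewrite -oppr_gt0 opprB => /gt_eqF->.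
  apply: within_continuousM ode_continuous.
  exact: within_continuous_ln ode_continuous ode_gt0.
have [c _ kc] := EVT_min ler01 ck.
apply: (@linear_ode_gt0 R (fun z => 1 - y z) k (- k c)) x01.
- exact: within_continuousB (@within_continuous_cst R _ R 1) ode_continuous.
- move=> z z01; have dy := ode_is_derive z01.
  apply: is_derive_eq; rewrite /ode_rhs /k -[_ * _ - z]opprB invrN; ring.
- by move=> z z01; rewrite opprK; exact/kc/subset_itv_oo_cc.
- by rewrite subr_gt0; case/andP: y0_itv.
Qed.

Lemma ode_nondecreasing : {in `[0, 1] &, {homo y : x z / x <= z}}.
Proof.
apply: is_derive_ge0_nondecreasing ode_is_derive _ ode_continuous => x.
move/subset_itv_oo_cc => x01; apply/ltW/ode_rhs_gt0/ode_denom_lt0 => //.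
by rewrite ode_gt0// ode_lt1.
Qed.

Definition ode_profile x : R := - 2^-1 * (ln (1 - y x) + x * ln (y x)).

Lemma is_derive_ode_profile :
  {in `]0, 1[, forall x, is_derive x (1 : R) ode_profile (- ln (y x))}.
Proof.
move=> x /[dup] /subset_itv_oo_cc x01 /ode_is_derive dy.
have y_gt0 := ode_gt0 x01; have := ode_denom_lt0 x01.
have y_lt1 : 0 < 1 - y x by rewrite subr_gt0 ode_lt1.
have dln := is_derive1_ln y_gt0; have dln1 := is_derive1_ln y_lt1.
move=> den; apply: is_derive_eq; rewrite /GRing.scale/= /ode_rhs.
by field; rewrite (lt_eqF den) !gt_eqF.
Qed.

Lemma ode_profile_continuous : {within `[0, 1], continuous ode_profile}.
Proof.
have cln1 : {within `[0, 1], continuous (@ln R \o (cst 1 - y))}.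
  apply: within_continuous_ln => [|x /ode_lt1]; last by rewrite /= subr_gt0.
  exact: within_continuousB (@within_continuous_cst R _ R 1) ode_continuous.
have cln : {within `[0, 1], continuous (@ln R \o y)}.
  exact: within_continuous_ln ode_continuous ode_gt0.
apply: within_continuousM (@within_continuous_cst _ _ _ _) _.
apply: within_continuousD cln1 _.
exact: within_continuousM (@within_continuous_id _ _) cln.
Qed.

Lemma ode_profile_le_tangent : {in `[0, 1] &, forall x z,
  ode_profile z <= ode_profile x - ln (y x) * (z - x)}.
Proof.
move=> x z x01 z01; rewrite -mulNr.
apply: (le_tangent_of_derive_nonincreasing is_derive_ode_profile) => //.
- exact: ode_profile_continuous.
- move=> u v u01 v01 uv.
  by rewrite lerN2 ler_ln ?posrE ?ode_gt0// ode_nondecreasing.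
Qed.

Lemma ramsey_mult_const_eventually_ge_ode l : ode_profile 1 < l ->
  \forall t \near \oo, expR (- (l * t%:R ^+ 2)) <= ramsey_mult_const R t.
Proof.
have slope_maxE x :
    slope_max ode_profile (fun z => - ln (y z)) x = - ln (1 - y x).
  by rewrite /slope_max /ode_profile; field.
apply: (@ramsey_mult_const_eventually_ge R ode_profile (fun x => - ln (y x))).
- move=> x x01; rewrite slope_maxE oppr_ge0 ln_le0//.
  by rewrite gerBl ltW// ode_gt0.
- by move=> x x01; rewrite oppr_ge0 ln_le0// ltW// ode_lt1.
- by move=> x z x01 z01; rewrite mulNr; exact: ode_profile_le_tangent.
- move=> x x01; rewrite slope_maxE !opprK.
  by rewrite !lnK ?posrE ?subr_gt0 ?ode_gt0 ?ode_lt1// subrK.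
Qed.

End Solution.

Lemma ode_comparison y z : solves_ode y -> solves_ode z ->
  0 < y 0 < 1 -> 0 < z 0 < 1 -> y 0 <= z 0 ->
  {in `[0, 1], forall x, y x <= z x}.
Proof.
move=> y_ode z_ode y0 z0 yz x x01; rewrite -subr_le0.
apply: (@has_deriv_within_lt0_le0 _ (y - z)) x01; rewrite ?subr_le0//.
  exact: within_continuousB (ode_continuous y_ode) (ode_continuous z_ode).
move=> c c01 zy; exists (ode_rhs c (y c) - ode_rhs c (z c)); last first.
  by apply: has_deriv_withinB; exact: ode_has_deriv_within.
rewrite subr_lt0 ode_rhs_decreasing//.
- by rewrite (itvP c01).
- exact: ode_gt0 z_ode _ c01.
- by rewrite -subr_gt0.
- exact: ode_lt1 y_ode y0 _ c01.
- exact: ode_denom_lt0 z_ode z0 _ c01.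
Qed.

End ODE.

Definition ramsey_base (R : realType) (u : R) : R := (u * (1 - u)) `^ (- 2^-1).

Lemma ln_ramsey_base (R : realType) (u : R) :
  ln (ramsey_base u) = - 2^-1 * ln (u * (1 - u)).
Proof. exact: ln_powR. Qed.

Lemma ln_ramsey_base_gt0 (R : realType) (u : R) :
  0 < u < 1 -> 0 < ln (ramsey_base u).
Proof.
move=> /andP[u0 u1]; rewrite ln_ramsey_base nmulr_rgt0 ?oppr_lt0//.
by rewrite ln_lt0//; apply/andP; split; nra.
Qed.

Section SmallInitialValue.
Variables (R : realType) (tau : R -> R -> R).
Hypothesis tau_ode : forall eps : R, 0 < eps < 1 ->
  tau eps 0 = eps /\ solves_ode (tau eps).

Let one01 : (1 : R) \in `[0, 1].
Proof. by rewrite bound_itvE. Qed.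

Lemma tau0_itv eps : 0 < eps < 1 -> 0 < tau eps 0 < 1.
Proof. by move=> e01; have [->] := tau_ode e01. Qed.

Lemma tau1_bounds eps : 0 < eps < 1 -> 2^-1 < tau eps 1 < 1.
Proof.
move=> e01; have [_ ode] := tau_ode e01; have tau0 := tau0_itv e01.
rewrite (ode_lt1 ode tau0 one01) andbT.
by have := ode_denom_lt0 ode tau0 one01; lra.
Qed.

Lemma nondecreasing_tau1 :
  {in `]0, 1[ &, {homo (fun eps => tau eps 1) : a b / a <= b}}.
Proof.
move=> a b a01 b01 ab; have [ta ode_a] := tau_ode a01.
have [tb ode_b] := tau_ode b01.
by apply: ode_comparison ode_a ode_b _ _ _ _ one01; rewrite ?ta ?tb.
Qed.

Lemma is_cvg_tau1 : cvg (tau eps 1 @[eps --> 0^'+]).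
Proof.
apply/cvg_ex; eexists.
apply: (@nondecreasing_at_right_cvgr R _ 0 (BLeft 1)) => //.
- by rewrite bnd_simp.
- exact: nondecreasing_tau1.
- by exists 2^-1 => r [e /= /tau1_bounds/andP[/ltW]] + _ <-.
Qed.

Let L : R := lim (tau eps 1 @[eps --> 0^'+]).

Lemma lim_tau1_itv : 0 < L < 1.
Proof.
have half01 : 0 < (2^-1 : R) < 1 by apply/andP; split; lra.
have half_le_L : 2^-1 <= L.
  apply: limr_ge is_cvg_tau1 _; near=> e.
  have /tau1_bounds/andP[/ltW//] : 0 < e < 1.
  by near: e; exact: nbhs_right_itvoo.
have L_le : L <= tau 2^-1 1.
  apply: limr_le is_cvg_tau1 _; near=> e.
  have /andP[e0 e_half] : 0 < e < 2^-1.
    by near: e; apply: nbhs_right_itvoo; case/andP: half01.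
  apply: nondecreasing_tau1 (ltW e_half) => //.
  by rewrite in_itv/= e0; lra.
have /andP[_ tau_half_lt1] := tau1_bounds half01.
by apply/andP; split; [lra|exact: le_lt_trans tau_half_lt1].
Unshelve. all: by end_near. Qed.

Lemma ln_ramsey_base_tau1_cvg :
  ln (ramsey_base (tau eps 1)) @[eps --> 0^'+] --> ln (ramsey_base L).
Proof.
have /andP[L0 L1] := lim_tau1_itv.
under eq_fun do rewrite ln_ramsey_base; rewrite ln_ramsey_base.
apply: cvgM; first exact: cvg_cst.
apply: continuous_cvg.
  by apply: continuous_ln; rewrite mulr_gt0// subr_gt0.
by apply: cvgM is_cvg_tau1 _; apply: cvgB is_cvg_tau1; exact: cvg_cst.
Qed.

Lemma ln_ramsey_mult_const_eventually_ge eta : 0 < eta ->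
  \forall t \near \oo, - ln (ramsey_mult_const R t) <=
    (1 + eta) * (ln (ramsey_base L) * t%:R ^+ 2).
Proof.
move=> eta0; set l := ln (ramsey_base L).
have l0 : 0 < l by exact/ln_ramsey_base_gt0/lim_tau1_itv.
have [eps [e01 eps_l]] : exists eps, 0 < eps < 1 /\
    ln (ramsey_base (tau eps 1)) < (1 + eta) * l.
  near (0 : R)^'+ => eps; exists eps; split.
    by near: eps; exact: nbhs_right_itvoo.
  near: eps; apply: (cvgr_lt _ ln_ramsey_base_tau1_cvg).
  by rewrite mulrDl mul1r ltrDl mulr_gt0.
have [_ ode] := tau_ode e01; have /andP[t0 t1] := tau1_bounds e01.
have profileE : ode_profile (tau eps) 1 = ln (ramsey_base (tau eps 1)).
  rewrite ln_ramsey_base /ode_profile mul1r lnM ?posrE ?subr_gt0//; last by lra.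
  by rewrite addrC.
rewrite -profileE in eps_l.
have := ramsey_mult_const_eventually_ge_ode ode (tau0_itv e01) eps_l.
apply: filterS => t ge_exp; rewrite mulrA lerNl -ler_expR lnK//.
by rewrite posrE ramsey_mult_const_gt0.
Unshelve. all: by end_near. Qed.

End SmallInitialValue.

Theorem theorem1 (R : realType) (tau : R -> R -> R)
  (tau_ode : forall eps : R, 0 < eps < 1 ->
     tau eps 0 = eps /\ solves_ode (tau eps)) :
  let L : R := lim (tau eps 1 @[eps --> 0^'+]) in
  let C : R := (L * (1 - L)) `^ (- 2^-1) in
  [/\ cvg (tau eps 1 @[eps --> 0^'+]),
      0 < L < 1 &
      exists o : nat -> R,
        o t @[t --> \oo] --> (0 : R) /\
        forall t : nat,
          C `^ (- ((1 + o t) * t%:R ^+ 2)) <= ramsey_mult_const R t].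
Proof.
move=> L C; have L01 : 0 < L < 1 := lim_tau1_itv tau_ode.
have lnC0 : 0 < ln C := ln_ramsey_base_gt0 L01.
have C0 : 0 < C by rewrite ltNge; apply: contraTN lnC0 => /ln0 ->; rewrite ltxx.
have [||eta eta0|o o0 bound] := @eventually_le_one_plus_o R
  (fun t => - ln (ramsey_mult_const R t)) (fun t => ln C * t%:R ^+ 2).
- by move=> t; rewrite mulr_ge0 ?sqr_ge0// ltW.
- move=> t /eqP; rewrite mulf_eq0 gt_eqF//= sqrf_eq0 pnatr_eq0 => /eqP ->.
  by rewrite oppr_le0 ln_ge0// ramsey_mult_const0_ge1.
- exact: ln_ramsey_mult_const_eventually_ge.
split=> //; first exact: is_cvg_tau1 tau_ode.
exists o; split=> // t; rewrite /powR (gt_eqF C0) -ler_ln ?posrE ?expR_gt0//.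
  rewrite expRK mulNr -mulrA lerNl [_ ^+ 2 * _]mulrC; exact: bound.
exact: ramsey_mult_const_gt0.
Qed.
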